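(* Let $n\ge 1$, let $\mathcal{D}_n\subseteq\mathcal{M}_n$ be the family of $n\times n$ complex diagonal matrices and let $\mathcal{B}_n\subseteq\mathcal{M}_n$ be the family of $n\times n$ complex principally balanced matrices. Then $\mathcal{D}_n$ and $\mathcal{B}_n$ form an additive finite free complementary pair, i.e. $\mathcal{D}_n^{\boxplus}=\mathcal{B}_n$ and $\mathcal{B}_n^{\boxplus}=\mathcal{D}_n$.
   Context: $\mathcal{M}_n=\mathbb{C}^{n\times n}$ and $\chi_A(x)=\det(xI-A)$. For polynomials $p(x)=\sum_{k=0}^n a_kx^{n-k}$ and $q(x)=\sum_{k=0}^n b_kx^{n-k}$ of degree $n$ over $\mathbb{C}$, the additive convolution is $p(x)\boxplus q(x)=\sum_{k=0}^n\Big(\sum_{i+j=k}\frac{\binom{n-i}{j}}{\binom{n}{j}}a_ib_j\Big)x^{n-k}$. Matrices $A,B\in\mathcal{M}_n$ are in additive finite free position (additive FFP) if $\chi_{A+B}(x)=\chi_A(x)\boxplus\chi_B(x)$. For $\mathcal{A}\subseteq\mathcal{M}_n$, $\mathcal{A}^{\boxplus}$ is the set of all $B\in\mathcal{M}_n$ that are in additive FFP with every $A\in\mathcal{A}$. Sets $\mathcal{V},\mathcal{W}\subseteq\mathcal{M}_n$ form an additive finite free complementary pair if $\mathcal{V}^{\boxplus}=\mathcal{W}$ and $\mathcal{W}^{\boxplus}=\mathcal{V}$. A matrix $B\in\mathcal{M}_n$ is principally balanced if for every $1\le i\le n$ all principal minors of $B$ of order $i$ have the same value. *)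

(* Defs.v *)
From mathcomp Require Import all_boot all_order all_algebra.
From mathcomp Require Import all_real_closed.
From mathcomp Require Import classical_sets reals.

Set Implicit Arguments.
Unset Strict Implicit.
Unset Printing Implicit Defensive.

Import GRing.Theory.
Local Open Scope ring_scope.
Local Open Scope complex_scope.
Local Open Scope classical_set_scope.

(* The coefficient of x^(n-k) is written a_k, so that a_k = p`_(n - k) and
   b_k = q`_(n - k).  The operation depends on n, and is meant for polynomials
   of degree n. *)
Definition add_conv (R : realType) (n : nat) (p q : {poly R[i]}) : {poly R[i]} :=
  \sum_(k < n.+1)
    (\sum_(i < n.+1) \sum_(j < n.+1 | (i + j == k)%N)
        ('C(n - i, j)%:R / 'C(n, j)%:R) * p`_(n - i) * q`_(n - j)) *: 'X^(n - k).

Definition add_ffp (R : realType) (n : nat) (A B : 'M[R[i]]_n) : Prop :=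
  char_poly (A + B) = add_conv n (char_poly A) (char_poly B).

Definition ffp_complement (R : realType) (n : nat) (V : set 'M[R[i]]_n) :
    set 'M[R[i]]_n :=
  [set B | forall A, V A -> add_ffp A B].

Definition add_ff_complementary_pair (R : realType) (n : nat)
    (V W : set 'M[R[i]]_n) : Prop :=
  ffp_complement V = W /\ ffp_complement W = V.

(* enum_val lists the elements of S in increasing order. *)
Definition principal_minor (R : realType) (n : nat) (B : 'M[R[i]]_n)
    (S : {set 'I_n}) : R[i] :=
  \det (mxsub (fun k : 'I_#|S| => enum_val k) (fun k : 'I_#|S| => enum_val k) B).

Definition principally_balanced (R : realType) (n : nat) (B : 'M[R[i]]_n) : Prop :=
  forall i : nat, (1 <= i <= n)%N ->
  forall S T : {set 'I_n}, #|S| = i -> #|T| = i ->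
    principal_minor B S = principal_minor B T.

Definition diagonal_matrices (R : realType) (n : nat) : set 'M[R[i]]_n :=
  [set A | is_diag_mx A].

Definition balanced_matrices (R : realType) (n : nat) : set 'M[R[i]]_n :=
  [set B | principally_balanced B].

Arguments diagonal_matrices : clear implicits.
Arguments balanced_matrices : clear implicits.

(* Main.v *)
Require Import Defs.
From mathcomp Require Import all_boot all_order all_algebra.
From mathcomp Require Import perm zify ring.
From mathcomp Require Import all_real_closed.
From mathcomp Require Import classical_sets reals.

(** Everything rests on one identity.  For a diagonal matrix with entries [a_i]
    and any [B], expanding the determinant of [(xI - diag a) - B] along the
    diagonal summand gives
      chi_(diag a + B) = sum over S of (-1)^|S| m_S(B) prod_(i not in S) (x - a_i),
    where [m_S(B)] is the principal minor of [B] on [S] ([char_poly_diagD]).  On the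
    other side, the additive convolution of [p] and [q] is
      sum over j of (q_(n-j) / C(n,j)) p^(j) / j!
    ([finite_free_convE]), and for [p = prod_i (x - a_i)] the polynomial
    [p^(j) / j!] is the sum of [prod_(i not in S) (x - a_i)] over the sets [S] of
    size [j] ([nderivn_prod_XsubC]).  So both sides of the free position identity
    are combinations of the same products, and their difference has coefficients
      (-1)^|S| m_S(B) - chi_B[x^(n-|S|)] / C(n,|S|)
    ([char_poly_sub_conv]).  Since [(-1)^j chi_B[x^(n-j)]] is the sum of the minors
    of order [j], the coefficient at [S] compares [m_S(B)] with the average of the
    principal minors of its order; all coefficients vanish exactly when [B] is
    principally balanced.  Conversely, letting [a] vary makes the difference,
    evaluated at [x = 0], a multilinear polynomial in the [a_i], which vanishes
    only if all its coefficients do.  Hence a matrix is in free position with every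
    diagonal matrix if and only if it is balanced ([add_ffp_diagP]).

    It remains to see that only diagonal matrices are in free position with all
    balanced ones.  The matrix unit [E_ij] with [i <> j] is balanced because all its
    nonempty principal minors vanish; for the same reason its characteristic
    polynomial is [x^n], the neutral element of the convolution.  If [A] is in free
    position with it, then [E_ij + A] and [A] have the same characteristic
    polynomial.  Comparing sums of principal minors of order 2, of which only the
    one on [{i, j}] changes, and by [- A_ji], gives [A_ji = 0] ([is_diag_mx_ffp]). *)

Set Implicit Arguments.
Unset Strict Implicit.
Unset Printing Implicit Defensive.

Import GRing.Theory Num.Theory.
Local Open Scope ring_scope.
Local Open Scope complex_scope.

(** * Principal minors *)

Section Minors.
Variables (R : comNzRingType).

(** Principal minors are needed over any commutative ring, since the expansion
    of a characteristic polynomial uses those of a matrix of polynomials. *)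
Definition minor_of n (M : 'M[R]_n) (S : {set 'I_n}) : R :=
  \det (mxsub (fun k : 'I_#|S| => enum_val k) (fun k : 'I_#|S| => enum_val k) M).

(** A principal minor in the guise of a determinant of full size: this is the
    form in which the Leibniz formula produces minors. *)
Definition unit_rows_outside n (M : 'M[R]_n) (S : {set 'I_n}) : 'M[R]_n :=
  \matrix_(i, j) if i \in S then M i j else (i == j)%:R.

(** A row outside the image of [f] is a row of the identity matrix; expanding
    along it deletes that row and column and lowers the size by one.  When no
    such row is left, [f] is a permutation, and applying it to both rows and
    columns leaves the determinant unchanged.  Any enumeration [f] of the index
    set is allowed, so that the result also shows that minors do not depend on it. *)
Lemma det_unit_rows_outside_codom n m (f : 'I_m -> 'I_n) (M : 'M[R]_n) :
  injective f ->
  \det (unit_rows_outside M [set i | i \in codom f]) = \det (mxsub f f M).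
Proof.
elim: n m f M => [|n IHn] m f M injf.
  have m0 : m = 0%N.
    by apply/eqP; rewrite -leqn0 -(card_ord 0) -{1}(card_ord m) (leq_card f).
  by subst m; rewrite !det_mx00.
have [/existsP[i0 fi0]|] := boolP [exists i, i \notin codom f]; last first.
  rewrite negb_exists => /forallP fonto.
  have fT i : i \in codom f by have := fonto i; rewrite negbK.
  have mn : m = n.+1.
    apply/eqP; rewrite -(card_ord m) -[n.+1]card_ord -(card_codom injf).
    by apply/eqP/eq_card => i; rewrite fT inE.
  subst m; have -> : mxsub f f M = row_perm (perm injf) (col_perm (perm injf) M).
    by apply/matrixP => i j; rewrite !mxE !permE.
  have -> : unit_rows_outside M [set i in codom f] = M.
    by apply/matrixP => i j; rewrite !mxE inE fT.
  by rewrite row_permE col_permE !det_mulmx !det_perm odd_permV mulrCA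
             -signr_addb addbb mulr1.
have f_lift k : {l | f k = lift i0 l}.
  case: (unliftP i0 (f k)) => [l ->|fk]; first by exists l.
  by case/negP: fi0; rewrite -fk codom_f.
pose g k := sval (f_lift k).
have fE : f =1 lift i0 \o g by move=> k; exact: (svalP (f_lift k)).
have injg : injective g by move=> k l gkl; apply: injf; rewrite !fE /= gkl.
rewrite (expand_det_row _ i0) (bigD1 i0) //= big1 ?addr0; last first.
  by move=> j ji0; rewrite mxE inE (negPf fi0) eq_sym (negPf ji0) mul0r.
rewrite mxE inE (negPf fi0) eqxx mul1r /cofactor addnn -signr_odd odd_double mul1r.
have -> : mxsub f f M = mxsub g g (mxsub (lift i0) (lift i0) M).
  by rewrite -mxsub_comp; apply/matrixP => k l; rewrite !mxE !fE.
rewrite -IHn //; congr (\det _); apply/matrixP => k l; rewrite !mxE !inE.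
have -> : (lift i0 k \in codom f) = (k \in codom g).
  apply/codomP/codomP => -[x Hx]; exists x; last by rewrite fE /= Hx.
  by apply: (@lift_inj _ i0); rewrite Hx fE.
by rewrite (inj_eq (@lift_inj _ i0)).
Qed.

Lemma det_unit_rows_outside n (M : 'M[R]_n) S :
  \det (unit_rows_outside M S) = minor_of M S.
Proof.
rewrite /minor_of -det_unit_rows_outside_codom; last exact: enum_val_inj.
congr (\det (unit_rows_outside _ _)); apply/setP => i; rewrite inE.
apply/idP/codomP => [iS|[k ->]]; last exact: enum_valP.
by exists (enum_rank_in iS i); rewrite enum_rankK_in.
Qed.

(** In the Leibniz formula each factor is [M i (s i)] or, when [s i = i], the
    diagonal entry [d i]; distributing the product chooses the set [S] of rows
    taken from [M], and what remains is a determinant whose rows outside [S] are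
    those of the identity. *)
Lemma det_diagD n (d : 'rV[R]_n) (M : 'M[R]_n) :
  \det (diag_mx d + M) = \sum_(S : {set 'I_n}) minor_of M S * \prod_(i in ~: S) d 0 i.
Proof.
under [RHS]eq_bigr => S _ do rewrite -det_unit_rows_outside /determinant mulr_suml.
rewrite [RHS]exchange_big /=; apply: eq_bigr => s _.
under [RHS]eq_bigr => S _ do rewrite -mulrA.
rewrite -mulr_sumr; congr (_ * _).
under eq_bigr => i _ do rewrite !mxE addrC.
rewrite (bigA_distr _ _ (fun i => M i (s i)) (fun i => d 0 i *+ (i == s i))) /=.
apply: eq_bigr => S _.
rewrite [X in _ * X](big_mkcond (fun i => i \in ~: S)) -big_split /=.
apply: eq_bigr => i _; rewrite !mxE inE; case: (i \in S) => /=; first by rewrite mulr1.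
by rewrite mulr_natl.
Qed.

Lemma minor_set2 n (M : 'M[R]_n) i j : i != j ->
  minor_of M [set i; j] = M i i * M j j - M i j * M j i.
Proof.
move=> ij; pose f (k : 'I_2) := if k == 0 then i else j.
have injf : injective f.
  move=> k l; rewrite /f => fkl; apply/val_inj; move: fkl.
  case: k => [[|[|[]]]] //= ?; case: l => [[|[|[]]]] //= ? /eqP; rewrite ?(negPf ij) //.
  by rewrite eq_sym (negPf ij).
have -> : minor_of M [set i; j] = \det (mxsub f f M).
  rewrite -det_unit_rows_outside -det_unit_rows_outside_codom //.
  congr (\det (unit_rows_outside _ _)); apply/setP => k; rewrite !inE.
  apply/orP/codomP => [[]/eqP->|[l ->]].
  - by exists 0.
  - by exists 1.
  by rewrite /f; case: ifP => _; [left|right].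
by rewrite (expand_det_row _ 0) !big_ord_recl big_ord0 /cofactor !det_mx11 !mxE /f /=
           expr0 expr1 mul1r mulN1r mulrN addr0.
Qed.

End Minors.

(** * Characteristic polynomials and derivatives of split polynomials *)

Section CharPoly.
Variable R : comNzRingType.

Lemma char_poly_diagD n (a : 'rV[R]_n) (B : 'M[R]_n) :
  char_poly (diag_mx a + B) =
  \sum_(S : {set 'I_n})
     ((-1) ^+ #|S| * minor_of B S) *: \prod_(i in ~: S) ('X - (a 0 i)%:P).
Proof.
have -> : char_poly (diag_mx a + B) =
    \det (diag_mx (\row_i ('X - (a 0 i)%:P)) + map_mx polyC (- B)).
  congr (\det _); apply/matrixP => i j; rewrite !mxE polyCD opprD polyCN addrA.
  by rewrite polyCMn -mulrnBl.
rewrite det_diagD; apply: eq_bigr => S _.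
have -> : minor_of (map_mx polyC (- B)) S = ((-1) ^+ #|S| * minor_of B S)%:P.
  rewrite /minor_of -map_mxsub det_map_mx -detZ; congr (\det _)%:P.
  by apply/matrixP => i j; rewrite !mxE mulN1r.
by rewrite mul_polyC; congr (_ *: _); apply: eq_bigr => i _; rewrite mxE.
Qed.

Lemma coef_char_poly n (B : 'M[R]_n) j : (j <= n)%N ->
  (char_poly B)`_(n - j) = (-1) ^+ j * \sum_(S : {set 'I_n} | #|S| == j) minor_of B S.
Proof.
move=> jn; have := char_poly_diagD 0 B.
rewrite linear0 add0r => ->; rewrite coef_sum [in RHS]big_mkcond mulr_sumr.
apply: eq_bigr => S _; have Sn : (#|S| <= n)%N by rewrite -[n in (_ <= n)%N]card_ord max_card.
under eq_bigr => i _ do rewrite mxE subr0.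
rewrite prodr_const coefZ coefXn (cardsCs (~: S)) finset.setCK card_ord eqn_sub2lE // eq_sym.
by case: eqP => [->|_]; rewrite ?mulr1 ?mulr0.
Qed.

(** Both sides are the coefficient of [y^j] in [prod_i (x + y - a_i)]: by Taylor's
    formula on the left, by distributing the product on the right.  In the proof
    [y] is the outer variable of [{poly {poly R}}]. *)
Lemma nderivn_prod_XsubC n (a : 'I_n -> R) j :
  (\prod_i ('X - (a i)%:P))^`N(j) =
  \sum_(S : {set 'I_n} | #|S| == j) \prod_(i in ~: S) ('X - (a i)%:P).
Proof.
set p := \prod_i _; set g : {poly R} -> {poly {poly R}} := map_poly polyC.
have evalX (q : {poly R}) : (map_poly polyC (g q)).['X%:P] = q%:P.
  by rewrite horner_map /= -[(g q).['X]]/(q \Po 'X) comp_polyXr.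
have taylor : (map_poly polyC (g p)).['X%:P + 'X] = \sum_(i < size p) (p^`N(i))%:P * 'X^i.
  rewrite nderiv_taylor; last exact: mulrC.
  rewrite !size_map_polyC; apply: eq_bigr => i _.
  by rewrite /g !nderivn_map evalX.
have expand : (map_poly polyC (g p)).['X%:P + 'X] =
    \sum_(S : {set 'I_n}) 'X^#|S| * (\prod_(i in ~: S) ('X - (a i)%:P))%:P.
  rewrite /g /p !rmorph_prod horner_prod.
  under eq_bigr => i _ do
    rewrite !rmorphB /= !map_polyX !map_polyC /= hornerXsubC addrAC addrC -polyCB.
  rewrite (bigA_distr _ _ (fun=> 'X) (fun i => ('X - (a i)%:P)%:P)); apply: eq_bigr => S _.
  rewrite -prodr_const rmorph_prod /=.
  rewrite [X in _ = X * _]big_mkcond [X in _ = _ * X]big_mkcond -big_split.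
  by apply: eq_bigr => i _; rewrite inE /=; case: (i \in S); rewrite /= ?mulr1 ?mul1r.
move: taylor; rewrite expand => /(congr1 (coefp j)).
rewrite /coefp !coef_sum => coefj.
transitivity (\sum_(i < size p) ((p^`N(i))%:P * 'X^i)`_j); last rewrite -coefj.
  have [pj|jp] := leqP (size p) j.
    rewrite nderivn_poly0 // big1 // => i _.
    by rewrite coefCM coefXn gtn_eqF ?mulr0 // (leq_trans (ltn_ord i)).
  rewrite (bigD1 (Ordinal jp)) //= big1 ?addr0 => [|i ij].
    by rewrite coefCM coefXn eqxx mulr1.
  rewrite coefCM coefXn; case: eqP => [ji|_]; last by rewrite mulr0.
  by case/eqP: ij; apply: val_inj.
rewrite [RHS]big_mkcond; apply: eq_bigr => S _; rewrite coefMC coefXn eq_sym.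
by case: ifP => _; rewrite ?mul1r ?mul0r.
Qed.

(** A multilinear polynomial function that vanishes on 0/1 vectors has zero
    coefficients: at the indicator of the complement of [S] only the coefficients
    at supersets of [S] contribute, so they vanish by induction on the size of
    that complement. *)
Lemma multilinear_eq0 n (h : {set 'I_n} -> R) :
  (forall a : 'I_n -> R, \sum_S h S * \prod_(i in ~: S) a i = 0) -> forall S, h S = 0.
Proof.
move=> h0 S; have [m] := ubnP #|~: S|; elim: m S => // m IHm S; rewrite ltnS => Sm.
have := h0 (fun i => (i \in ~: S)%:R); rewrite (bigD1 S) //= [X in X + _]mulrC.
rewrite [X in X * _]big1 => [|i ->//]; rewrite mul1r big1 ?addr0 // => T TS.
have [ST|/subsetPn[i iT iS]] := boolP (~: T \subset ~: S); last first.
  by rewrite (bigD1 i) //= (negPf iS) mul0r mulr0.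
rewrite IHm ?mul0r //; apply: leq_trans Sm; apply: proper_card.
by rewrite finset.properEneq ST andbT; apply: contraNneq TS => /finset.setC_inj ->.
Qed.
End CharPoly.

(** * The additive convolution *)

Section Convolution.
Variables (K : numFieldType) (n : nat).
Implicit Types (p q : {poly K}).

(** The additive convolution over an arbitrary numeric field: what matters of the
    complex numbers is that the binomials are invertible. *)
Definition finite_free_conv p q : {poly K} :=
  \sum_(k < n.+1)
    (\sum_(i < n.+1) \sum_(j < n.+1 | (i + j == k)%N)
        ('C(n - i, j)%:R / 'C(n, j)%:R) * p`_(n - i) * q`_(n - j)) *: 'X^(n - k).

(** The binomial [C(n - i, j)] is the factor that the divided derivative of order
    [j] produces on [x^(n-i)]. *)
Lemma finite_free_convE p q : (size p <= n.+1)%N ->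
  finite_free_conv p q = \sum_(j < n.+1) (q`_(n - j) / 'C(n, j)%:R) *: p^`N(j).
Proof.
move=> sp.
(* When [i + j > n] the truncated exponent is harmless, as the binomial is 0. *)
have pE j : p^`N(j) = \sum_(i < n.+1) ('C(n - i, j)%:R * p`_(n - i)) *: 'X^(n - i - j).
  rewrite -[p in LHS](coefK) poly_def raddf_sum /=.
  rewrite (big_ord_widen n.+1 (fun i => (p`_i *: 'X^i)^`N(j))) //.
  rewrite big_mkcond (reindex_inj rev_ord_inj) /=; apply: eq_bigr => i _.
  rewrite subSS; case: ltnP => [_|pi].
    by rewrite nderivnZ nderivnXn -scaler_nat scalerA mulrC.
  by rewrite nth_default // mulr0 scale0r.
under [RHS]eq_bigr => j _ do rewrite pE scaler_sumr.
rewrite [RHS]exchange_big /finite_free_conv.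
under [LHS]eq_bigr => k _ do rewrite scaler_suml.
rewrite [LHS]exchange_big /=; apply: eq_bigr => i _.
under [LHS]eq_bigr => k _ do rewrite scaler_suml big_mkcond.
rewrite [LHS]exchange_big /=; apply: eq_bigr => j _.
rewrite -big_mkcond /= scalerA.
have [ijn|nij] := leqP (i + j) n.
  rewrite (big_pred1 (Ordinal (ijn : (i + j < n.+1)%N))) => [|k]; last first.
    by rewrite /= eq_sym.
  rewrite /= subnDA mulrC -[in RHS]mulrA; congr (_ * _ *: _).
  by rewrite -mulrA mulrCA.
rewrite big_pred0 => [|k]; last by apply: contraTF (ltn_ord k) => /eqP<-; rewrite -leqNgt.
have -> : 'C(n - i, j) = 0%N by apply: bin_small; rewrite ltn_subLR // -ltnS ltn_ord.
by rewrite mul0r mulr0 scale0r.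
Qed.

(** Both sides are the trinomial coefficient [n! / (i! j! (n - i - j)!)] when
    [i + j <= n], and 0 otherwise. *)
Lemma bin_subC i j : ('C(n - i, j) * 'C(n, i) = 'C(n - j, i) * 'C(n, j))%N.
Proof.
have [ijn|nij] := leqP (i + j) n; last first.
  have small k l : (n < k + l)%N -> ('C(n - k, l) * 'C(n, k) = 0)%N.
    move=> nkl; have [kn|nk] := leqP k n; last by rewrite (bin_small nk) muln0.
    by rewrite bin_small // ltn_subLR.
  by rewrite !small // addnC.
have trinomial k l : (k + l <= n)%N ->
    ('C(n - k, l) * 'C(n, k) * (k`! * l`! * (n - k - l)`!) = n`!)%N.
  move=> kln; have kn : (k <= n)%N by apply: leq_trans kln; exact: leq_addr.
  by rewrite -(bin_fact kn) -(@bin_fact (n - k) l) ?leq_subRL //; nia.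
apply/eqP; rewrite -(@eqn_pmul2r (i`! * j`! * (n - i - j)`!)) ?muln_gt0 ?fact_gt0 //.
by rewrite trinomial // [(i`! * j`!)%N]mulnC subnAC trinomial // addnC.
Qed.

Lemma finite_free_convC p q : finite_free_conv p q = finite_free_conv q p.
Proof.
apply: eq_bigr => k _; congr (_ *: _).
under eq_bigr => i _ do rewrite big_mkcond.
rewrite exchange_big; apply: eq_bigr => j _.
rewrite [RHS]big_mkcond; apply: eq_bigr => i _; rewrite addnC; case: ifP => // _.
rewrite mulrAC; congr (_ * _ * _).
have bn0 (l : 'I_n.+1) : 'C(n, l)%:R != 0 :> K.
  by rewrite pnatr_eq0 -lt0n bin_gt0 -ltnS.
by apply/eqP; rewrite eqr_div // -!natrM bin_subC.
Qed.

End Convolution.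

(** * Free position with diagonal matrices and with matrix units *)

Section ComplementaryPair.
Variables (K : numFieldType) (n : nat).
Implicit Types (A B : 'M[K]_n) (S T : {set 'I_n}).

(** Up to sign, the difference between the minor of [B] on [S] and the average of
    its principal minors of the same order. *)
Definition minor_defect B S : K :=
  (-1) ^+ #|S| * minor_of B S - (char_poly B)`_(n - #|S|) / 'C(n, #|S|)%:R.

Lemma char_poly_sub_conv (a : 'rV_n) B :
  char_poly (diag_mx a + B) - finite_free_conv n (char_poly (diag_mx a)) (char_poly B) =
  \sum_S minor_defect B S *: \prod_(i in ~: S) ('X - (a 0 i)%:P).
Proof.
rewrite finite_free_convE ?size_char_poly //.
have -> : char_poly (diag_mx a) = \prod_i ('X - (a 0 i)%:P).
  rewrite char_poly_trig ?diag_mx_is_trig //.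
  by apply: eq_bigr => i _; rewrite mxE eqxx.
rewrite char_poly_diagD.
under [X in _ - X]eq_bigr => j _ do rewrite nderivn_prod_XsubC scaler_sumr.
rewrite (exchange_big_dep predT) //= -sumrB; apply: eq_bigr => S _.
have Sn : (#|S| < n.+1)%N by rewrite ltnS -[n in (_ <= n)%N]card_ord max_card.
rewrite (big_pred1 (Ordinal Sn)) => [|j]; last by rewrite /= eq_sym.
by rewrite -scalerBl.
Qed.

(** A vanishing defect makes the minor a function of the size of [S] alone;
    conversely, a value common to all minors of one order is their average. *)
Lemma minor_defect_eq0P B :
  (forall S, minor_defect B S = 0) <->
  (forall S T, #|S| = #|T| -> minor_of B S = minor_of B T).
Proof.
split=> [B0 S T ST|balB S].
  have := B0 T; have := B0 S; rewrite /minor_defect ST => /eqP.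
  rewrite subr_eq0 => /eqP <- /eqP; rewrite subr_eq0 => /eqP.
  by move=> /(mulfI (negbT (signr_eq0 _ _))).
have Sn : (#|S| <= n)%N by rewrite -[n in (_ <= n)%N]card_ord max_card.
rewrite /minor_defect coef_char_poly //.
rewrite (eq_bigr (fun=> minor_of B S)) => [|T /eqP/balB//].
rewrite (eq_bigl (mem [set T : {set 'I_n} | #|T| == #|S|])) => [|T];
  last by rewrite -[RHS]/(T \in _) inE.
rewrite sumr_const card_draws card_ord.
rewrite mulrnAr -[in X in _ - X]mulr_natr mulfK ?subrr //.
by rewrite pnatr_eq0 -lt0n bin_gt0.
Qed.

Lemma add_ffp_diagP B :
  (forall a : 'rV_n, char_poly (diag_mx a + B) =
     finite_free_conv n (char_poly (diag_mx a)) (char_poly B)) <->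
  (forall S T, #|S| = #|T| -> minor_of B S = minor_of B T).
Proof.
rewrite -minor_defect_eq0P; split=> [ffp|B0 a]; last first.
  apply/eqP; rewrite -subr_eq0 char_poly_sub_conv big1 // => S _.
  by rewrite B0 scale0r.
apply: multilinear_eq0 => a.
(* The sign turns [x - a_i] into [a_i] at [x = 0]. *)
have /eqP := ffp (\row_i - a i); rewrite -subr_eq0 char_poly_sub_conv.
move=> /eqP/(congr1 (horner^~ 0)); rewrite horner0 horner_sum => {2}<-.
apply: eq_bigr => S _; rewrite hornerZ horner_prod; congr (_ * _).
by apply: eq_bigr => i _; rewrite hornerXsubC mxE sub0r opprK.
Qed.

(** The submatrix has a zero row: the row [j] if [j] is in [S]; if it is not, the
    column of the only nonzero entry is missing and any row will do. *)
Lemma minor_delta_mx (i j : 'I_n) S :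
  i != j -> (0 < #|S|)%N -> minor_of (delta_mx i j : 'M[K]_n) S = 0.
Proof.
move=> ij /card_gt0P[x0 x0S].
have [x xS xi] : exists2 x, x \in S & (x != i) || (j \notin S).
  by have [jS|jS] := boolP (j \in S); [exists j; rewrite // eq_sym ij|exists x0; rewrite ?orbT].
rewrite /minor_of (expand_det_row _ (enum_rank_in xS x)) big1 // => k _.
rewrite !mxE enum_rankK_in //; case: eqP xi => [_ /= jS|_ _]; last by rewrite mul0r.
by case: eqP => [kj|_]; [rewrite -kj enum_valP in jS|rewrite mul0r].
Qed.

(** Only the leading coefficient of the characteristic polynomial of the matrix
    unit survives, and [x^n] is neutral for the convolution. *)
Lemma add_ffp_delta_mxE (i j : 'I_n) A : i != j ->
  char_poly (delta_mx i j + A) =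
  finite_free_conv n (char_poly (delta_mx i j)) (char_poly A) ->
  char_poly (delta_mx i j + A) = char_poly A.
Proof.
move=> ij ->; rewrite finite_free_convC finite_free_convE ?size_char_poly // big_ord_recl /=.
rewrite big1 => [|k _]; last first.
  rewrite coef_char_poly // big1 ?mulr0 ?mul0r ?scale0r // => S /eqP Sk.
  by rewrite minor_delta_mx // Sk.
rewrite addr0 subn0 nderivn0 bin0 divr1.
have /monicP := char_poly_monic (delta_mx i j : 'M[K]_n).
by rewrite lead_coefE size_char_poly => ->; rewrite scale1r.
Qed.

(** The coefficient of [x^(n-2)] is the sum of the principal minors of order 2.
    Adding the matrix unit at [(i, j)] changes only the one on [{i, j}], where it
    subtracts [A j i]. *)
Lemma is_diag_mx_ffp A :
  (forall i j : 'I_n, i != j -> char_poly (delta_mx i j + A) =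
  finite_free_conv n (char_poly (delta_mx i j)) (char_poly A)) -> is_diag_mx A.
Proof.
move=> ffp; apply/is_diag_mxP => j i; rewrite val_eqE eq_sym => ij.
have n2 : (2 <= n)%N.
  by have := max_card (mem [set i; j]); rewrite card_ord cards2 ij.
have := congr1 (fun p : {poly _} => p`_(n - 2)) (add_ffp_delta_mxE ij (ffp i j ij)).
rewrite !coef_char_poly // => /(mulfI (negbT (signr_eq0 _ _)))/eqP.
rewrite -subr_eq0 -sumrB (bigD1 [set i; j]) /=; last by rewrite cards2 ij.
rewrite big1 => [|S /andP[/cards2P[k [l [kl ->]]] Sij]].
  rewrite !minor_set2 // !mxE !eqxx (eq_sym j i) (negPf ij) /= => /eqP e.
  by apply: oppr_inj; rewrite oppr0 -[RHS]e; ring.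
have diag0 x : (x == i) && (x == j) = false.
  by apply: contraNF ij => /andP[/eqP<-].
have kl0 : (k == i) && (l == j) = false.
  by apply: contraNF Sij => /andP[/eqP-> /eqP->].
have lk0 : (l == i) && (k == j) = false.
  by apply: contraNF Sij => /andP[/eqP-> /eqP->]; rewrite finset.setUC.
by rewrite !minor_set2 // !mxE !diag0 kl0 lk0 !add0r subrr.
Qed.
End ComplementaryPair.

Theorem theorem4p7 (R : realType) (n : nat) (hn : (1 <= n)%N) :
  add_ff_complementary_pair (diagonal_matrices R n) (balanced_matrices R n).
Proof.
have balancedP (B : 'M[R[i]]_n) : principally_balanced B <->
    forall S T : {set 'I_n}, #|S| = #|T| -> minor_of B S = minor_of B T.
  split=> [balB S T ST|balB k _ S T Sk Tk]; last by apply: balB; rewrite Sk.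
  have [S0|S_gt0] := posnP #|S|.
    by have /cards0_eq-> := S0; move: ST; rewrite S0 => /esym/cards0_eq->.
  by apply: (balB #|S|); rewrite // S_gt0 -[n in (_ <= n)%N]card_ord max_card.
split; apply/seteqP; split=> [B ffp|B BW].
- by apply/balancedP/add_ffp_diagP => a; apply: ffp; exact: diag_mx_is_diag.
- by move/balancedP/add_ffp_diagP: BW => ffp _ /diag_mxP[a ->]; exact: ffp.
- apply: is_diag_mx_ffp => i j ij; apply: ffp => k /andP[k_gt0 _] S T Sk Tk.
  by apply: etrans (esym _); apply: minor_delta_mx; rewrite ?Sk ?Tk.
- move=> A balA; case/diag_mxP: BW => a ->; rewrite /add_ffp addrC.
  apply: etrans (finite_free_convC _ _ _).
  by move/balancedP/add_ffp_diagP: balA; apply.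
Qed.
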